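(* Let $\mathcal{A}$ be a complex Banach algebra with identity, $\lambda$ a nonzero complex number, and $M = \begin{pmatrix} A & B \\ C & D \end{pmatrix} \in M_2(\mathcal{A})$ with $A, D \in \mathcal{A}^d$. Suppose $BC, CB \in \mathcal{A}^d$ (so that the expressions below make sense), and $$BD = \lambda (BC)^\pi A B D^\pi \quad\text{and}\quad CA = \lambda (CB)^\pi D C A^\pi.$$ Put $P = \begin{pmatrix} A & 0 \\ 0 & D \end{pmatrix}$ and $Q = \begin{pmatrix} 0 & B \\ C & 0 \end{pmatrix}$, so $M=P+Q$, $P^d=\begin{pmatrix} A^d & 0 \\ 0 & D^d \end{pmatrix}$, $Q^d=\begin{pmatrix} 0 & B(CB)^d \\ C(BC)^d & 0 \end{pmatrix}$. Then $M \in M_2(\mathcal{A})^d$ and $$\begin{aligned} M^d ={}& \begin{pmatrix} A^d(BC)^\pi & A^\pi B(CB)^d \\ D^\pi C(BC)^d & D^d(CB)^\pi \end{pmatrix} + \sum_{n=0}^{\infty} (P^d)^{n+2} Q M^n Q^\pi + P^\pi \sum_{n=0}^{\infty} M^n P (Q^d)^{n+2} \\ &- \sum_{n=0}^{\infty} \sum_{k=0}^{\infty} (P^d)^{k+1} Q M^{n+k} P (Q^d)^{n+2} - \sum_{n=0}^{\infty} (P^d)^{n+2} Q M^n P Q^d.\end{aligned}$$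
   Context: $M_2(\mathcal{A})$ is the Banach algebra of $2\times 2$ matrices over $\mathcal{A}$. $\mathcal{A}^{qnil}$ is the set of quasinilpotent elements ($\lim\|x^n\|^{1/n}=0$). An element $x$ of a Banach algebra has a generalized Drazin (g-Drazin) inverse $x^d$ if $x^d$ commutes with $x$, $x^d = x^dxx^d$ and $x - x^2x^d$ is quasinilpotent; $\mathcal{A}^d$ (resp. $M_2(\mathcal{A})^d$) denotes the set of g-Drazin invertible elements. The spectral idempotent is $x^\pi = 1 - xx^d$ (with $1$ the relevant identity). *)

(* Defs.v *)
From Stdlib Require Import Reals.
Open Scope R_scope.

Record Cplx := mkC { Cre : R; Cim : R }.
Definition C0 : Cplx := mkC 0 0.
Definition C1 : Cplx := mkC 1 0.
Definition Cadd (z w : Cplx) : Cplx := mkC (Cre z + Cre w) (Cim z + Cim w).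
Definition Cmul (z w : Cplx) : Cplx :=
  mkC (Cre z * Cre w - Cim z * Cim w) (Cre z * Cim w + Cim z * Cre w).
Definition Cmod (z : Cplx) : R := sqrt (Cre z ^ 2 + Cim z ^ 2).

Record NAlg := {
  car :> Type;
  zero : car;
  one : car;
  add : car -> car -> car;
  opp : car -> car;
  mul : car -> car -> car;
  scal : Cplx -> car -> car;
  norm : car -> R }.
Arguments zero {_}. Arguments one {_}. Arguments add {_}. Arguments opp {_}.
Arguments mul {_}. Arguments scal {_}. Arguments norm {_}.

Infix "|+|" := add (at level 50, left associativity).
Infix "**" := mul (at level 40, left associativity).
Definition sub {A : NAlg} (x y : A) : A := x |+| opp y.
Infix "|-|" := sub (at level 50, left associativity).

Fixpoint apow {A : NAlg} (x : A) (n : nat) : A :=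
  match n with O => one | S m => x ** apow x m end.

Definition converges_to {A : NAlg} (u : nat -> A) (l : A) : Prop :=
  forall eps, eps > 0 -> exists N, forall n, (n >= N)%nat -> norm (u n |-| l) < eps.

Definition cauchy {A : NAlg} (u : nat -> A) : Prop :=
  forall eps, eps > 0 -> exists N, forall m n, (m >= N)%nat -> (n >= N)%nat ->
    norm (u m |-| u n) < eps.

Definition banach_algebra (A : NAlg) : Prop :=
  (forall x y z : A, x |+| (y |+| z) = (x |+| y) |+| z) /\
  (forall x y : A, x |+| y = y |+| x) /\
  (forall x : A, x |+| zero = x) /\
  (forall x : A, x |+| opp x = zero) /\
  (forall x y z : A, x ** (y ** z) = (x ** y) ** z) /\
  (forall x : A, one ** x = x) /\
  (forall x : A, x ** one = x) /\
  (forall x y z : A, x ** (y |+| z) = x ** y |+| x ** z) /\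
  (forall x y z : A, (x |+| y) ** z = x ** z |+| y ** z) /\
  (forall (a b : Cplx) (x : A), scal (Cmul a b) x = scal a (scal b x)) /\
  (forall x : A, scal C1 x = x) /\
  (forall (a b : Cplx) (x : A), scal (Cadd a b) x = scal a x |+| scal b x) /\
  (forall (a : Cplx) (x y : A), scal a (x |+| y) = scal a x |+| scal a y) /\
  (forall (a : Cplx) (x y : A), scal a (x ** y) = scal a x ** y) /\
  (forall (a : Cplx) (x y : A), scal a (x ** y) = x ** scal a y) /\
  (forall x : A, 0 <= norm x) /\
  (forall x : A, norm x = 0 -> x = zero) /\
  (forall x y : A, norm (x |+| y) <= norm x + norm y) /\
  (forall (a : Cplx) (x : A), norm (scal a x) = Cmod a * norm x) /\
  (forall x y : A, norm (x ** y) <= norm x * norm y) /\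
  (forall u : nat -> A, cauchy u -> exists l, converges_to u l).

Definition nroot (r : R) (n : nat) : R :=
  if Rle_dec r 0 then 0 else Rpower r (/ INR n).

Definition qnil {A : NAlg} (x : A) : Prop :=
  Un_cv (fun n => nroot (norm (apow x n)) n) 0.

Definition gdrazin_inv {A : NAlg} (x y : A) : Prop :=
  y ** x = x ** y /\ y = y ** x ** y /\ qnil (x |-| x ** x ** y).

Definition spi {A : NAlg} (x xd : A) : A := one |-| x ** xd.

Fixpoint psum {A : NAlg} (f : nat -> A) (n : nat) : A :=
  match n with O => f O | S m => psum f m |+| f (S m) end.
Definition has_sum {A : NAlg} (f : nat -> A) (S : A) : Prop :=
  converges_to (psum f) S.

Record Mat2 (A : Type) := mk2 { m11 : A; m12 : A; m21 : A; m22 : A }.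
Arguments mk2 {A}. Arguments m11 {A}. Arguments m12 {A}.
Arguments m21 {A}. Arguments m22 {A}.

Definition M2 (A : NAlg) : NAlg := {|
  car := Mat2 A;
  zero := mk2 zero zero zero zero;
  one := mk2 one zero zero one;
  add := fun X Y => mk2 (m11 X |+| m11 Y) (m12 X |+| m12 Y)
                        (m21 X |+| m21 Y) (m22 X |+| m22 Y);
  opp := fun X => mk2 (opp (m11 X)) (opp (m12 X)) (opp (m21 X)) (opp (m22 X));
  mul := fun X Y => mk2 (m11 X ** m11 Y |+| m12 X ** m21 Y)
                        (m11 X ** m12 Y |+| m12 X ** m22 Y)
                        (m21 X ** m11 Y |+| m22 X ** m21 Y)
                        (m21 X ** m12 Y |+| m22 X ** m22 Y);
  scal := fun a X => mk2 (scal a (m11 X)) (scal a (m12 X))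
                         (scal a (m21 X)) (scal a (m22 X));
  norm := fun X => norm (m11 X) + norm (m12 X) + norm (m21 X) + norm (m22 X) |}.

(* Main.v *)
Require Import Defs.
From Stdlib Require Import Reals Lra Lia.

(** The hypothesis says [QP = lam Q^pi P Q P^pi].  Multiplying by [Q^d] on the left
    or [P^d] on the right gives [Q^d P = 0] and [Q P^d = 0], so that the hypothesis
    becomes [QP = lam PQ].  Then [z = P^d Q] satisfies [z = u z p] with [p = P P^pi]
    quasinilpotent, and iterating forces [z = 0]; likewise [P Q^d = 0].  Hence all
    four series vanish and [M^d = P^d + Q^d].  What remains is that [P P^pi + Q Q^pi]
    is quasinilpotent, being the sum of two quasinilpotents that commute up to the
    factor [lam]. *)

(* The axioms of a Banach algebra, one by one *)
Existing Class banach_algebra.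

Ltac banach_axiom := intros ? HA; intros; unfold banach_algebra in HA;
  decompose [and] HA; solve [auto].

Lemma addA : forall A (HA : banach_algebra A) (x y z : A),
  x |+| (y |+| z) = x |+| y |+| z.
Proof. banach_axiom. Qed.
Lemma addC : forall A (HA : banach_algebra A) (x y : A), x |+| y = y |+| x.
Proof. banach_axiom. Qed.
Lemma addx0 : forall A (HA : banach_algebra A) (x : A), x |+| zero = x.
Proof. banach_axiom. Qed.
Lemma addxN : forall A (HA : banach_algebra A) (x : A), x |+| opp x = zero.
Proof. banach_axiom. Qed.
Lemma mulA : forall A (HA : banach_algebra A) (x y z : A),
  x ** (y ** z) = x ** y ** z.
Proof. banach_axiom. Qed.
Lemma mul1x : forall A (HA : banach_algebra A) (x : A), one ** x = x.
Proof. banach_axiom. Qed.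
Lemma mulx1 : forall A (HA : banach_algebra A) (x : A), x ** one = x.
Proof. banach_axiom. Qed.
Lemma mulDr : forall A (HA : banach_algebra A) (x y z : A),
  x ** (y |+| z) = x ** y |+| x ** z.
Proof. banach_axiom. Qed.
Lemma mulDl : forall A (HA : banach_algebra A) (x y z : A),
  (x |+| y) ** z = x ** z |+| y ** z.
Proof. banach_axiom. Qed.
Lemma scalM : forall A (HA : banach_algebra A) s t (x : A),
  scal (Cmul s t) x = scal s (scal t x).
Proof. banach_axiom. Qed.
Lemma scal1 : forall A (HA : banach_algebra A) (x : A), scal Defs.C1 x = x.
Proof. banach_axiom. Qed.
Lemma scalDl : forall A (HA : banach_algebra A) s t (x : A),
  scal (Cadd s t) x = scal s x |+| scal t x.
Proof. banach_axiom. Qed.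
Lemma scalDr : forall A (HA : banach_algebra A) s (x y : A),
  scal s (x |+| y) = scal s x |+| scal s y.
Proof. banach_axiom. Qed.
Lemma scal_mull : forall A (HA : banach_algebra A) s (x y : A),
  scal s (x ** y) = scal s x ** y.
Proof. banach_axiom. Qed.
Lemma scal_mulr : forall A (HA : banach_algebra A) s (x y : A),
  scal s (x ** y) = x ** scal s y.
Proof. banach_axiom. Qed.
Lemma norm_ge0 : forall A (HA : banach_algebra A) (x : A), 0 <= norm x.
Proof. banach_axiom. Qed.
Lemma norm_eq0 : forall A (HA : banach_algebra A) (x : A), norm x = 0 -> x = zero.
Proof. banach_axiom. Qed.
Lemma norm_add : forall A (HA : banach_algebra A) (x y : A),
  norm (x |+| y) <= norm x + norm y.
Proof. banach_axiom. Qed.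
Lemma norm_scal : forall A (HA : banach_algebra A) s (x : A),
  norm (scal s x) = Cmod s * norm x.
Proof. banach_axiom. Qed.
Lemma norm_mul : forall A (HA : banach_algebra A) (x y : A),
  norm (x ** y) <= norm x * norm y.
Proof. banach_axiom. Qed.
Lemma banach_complete : forall A (HA : banach_algebra A) (u : nat -> A),
  cauchy u -> exists l, converges_to u l.
Proof. banach_axiom. Qed.

Arguments addA {A HA}. Arguments addC {A HA}. Arguments addx0 {A HA}.
Arguments addxN {A HA}. Arguments mulA {A HA}. Arguments mul1x {A HA}.
Arguments mulx1 {A HA}. Arguments mulDr {A HA}. Arguments mulDl {A HA}.
Arguments scalM {A HA}. Arguments scal1 {A HA}. Arguments scalDl {A HA}.
Arguments scalDr {A HA}. Arguments scal_mull {A HA}. Arguments scal_mulr {A HA}.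
Arguments norm_ge0 {A HA}. Arguments norm_eq0 {A HA}. Arguments norm_add {A HA}.
Arguments norm_scal {A HA}. Arguments norm_mul {A HA}.
Arguments banach_complete {A HA}.

(** * Ring identities *)

Lemma add0x {A} {HA : banach_algebra A} (x : A) : zero |+| x = x.
Proof. now rewrite addC, addx0. Qed.

(** Most zero and sign rules below come from adding a common term to both sides and cancelling
    it. *)
Lemma add_cancel {A} {HA : banach_algebra A} (x y z : A) :
  x |+| y = x |+| z -> y = z.
Proof.
  intros E.
  rewrite <- (add0x y), <- (add0x z), <- (addxN x), (addC x (opp x)), <- !addA.
  now rewrite E.
Qed.

Lemma mulx0 {A} {HA : banach_algebra A} (x : A) : x ** zero = zero.
Proof. apply (add_cancel (x ** zero)). now rewrite <- mulDr, !addx0. Qed.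

Lemma mul0x {A} {HA : banach_algebra A} (x : A) : zero ** x = zero.
Proof. apply (add_cancel (zero ** x)). now rewrite <- mulDl, !addx0. Qed.

Lemma scalx0 {A} {HA : banach_algebra A} s : scal s (@zero A) = zero.
Proof. apply (add_cancel (scal s zero)). now rewrite <- scalDr, !addx0. Qed.

Lemma opp_mull {A} {HA : banach_algebra A} (x y : A) : opp x ** y = opp (x ** y).
Proof. apply (add_cancel (x ** y)). now rewrite <- mulDl, !addxN, mul0x. Qed.

Lemma opp_mulr {A} {HA : banach_algebra A} (x y : A) : x ** opp y = opp (x ** y).
Proof. apply (add_cancel (x ** y)). now rewrite <- mulDr, !addxN, mulx0. Qed.

Lemma opp0 {A} {HA : banach_algebra A} : opp (@zero A) = zero.
Proof. apply (add_cancel zero). now rewrite addxN, addx0. Qed.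

Lemma mulBr {A} {HA : banach_algebra A} (x y z : A) :
  x ** (y |-| z) = x ** y |-| x ** z.
Proof. unfold sub. now rewrite mulDr, opp_mulr. Qed.

Lemma mulBl {A} {HA : banach_algebra A} (x y z : A) :
  (x |-| y) ** z = x ** z |-| y ** z.
Proof. unfold sub. now rewrite mulDl, opp_mull. Qed.

Lemma subxx {A} {HA : banach_algebra A} (x : A) : x |-| x = zero.
Proof. apply addxN. Qed.

Lemma subx0 {A} {HA : banach_algebra A} (x : A) : x |-| zero = x.
Proof. unfold sub. now rewrite opp0, addx0. Qed.

Lemma sub_eq0 {A} {HA : banach_algebra A} (x y : A) : x |-| y = zero -> x = y.
Proof.
  intros E. apply (add_cancel (opp y)).
  now rewrite (addC _ y), addxN, addC.
Qed.

Lemma oppD {A} {HA : banach_algebra A} (x y : A) :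
  opp (x |+| y) = opp x |+| opp y.
Proof.
  apply (add_cancel (x |+| y)).
  rewrite addxN, (addC x y), addA, <- (addA y x), addxN, addx0.
  now rewrite addxN.
Qed.

Lemma addBB {A} {HA : banach_algebra A} (x y z t : A) :
  (x |+| y) |-| (z |+| t) = (x |-| z) |+| (y |-| t).
Proof.
  unfold sub. rewrite oppD, <- !addA. f_equal.
  now rewrite !addA, (addC y).
Qed.

(** * Norms, powers and quasinilpotence *)

Lemma Cmod_ge0 s : 0 <= Cmod s.
Proof. apply sqrt_pos. Qed.

Lemma Cmod_mul s t : Cmod (Cmul s t) = Cmod s * Cmod t.
Proof.
  unfold Cmod. rewrite <- sqrt_mult by nra.
  apply (f_equal sqrt). unfold Cmul, Cre, Cim. destruct s, t. ring.
Qed.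

Lemma Cinv_exists s : s <> C0 -> exists t, Cmul t s = Defs.C1.
Proof.
  destruct s as [x y]. intros N.
  assert (D : x * x + y * y <> 0).
  { intros E. apply N. unfold C0. f_equal; nra. }
  exists (mkC (x / (x * x + y * y)) (- y / (x * x + y * y))).
  unfold Cmul, Defs.C1; cbn. f_equal; field; auto.
Qed.

Lemma Cmod_C1 : Cmod Defs.C1 = 1.
Proof.
  unfold Cmod; cbn. transitivity (sqrt 1); [f_equal; ring | apply sqrt_1].
Qed.

Lemma norm_zero {A} {HA : banach_algebra A} : norm (@zero A) = 0.
Proof.
  rewrite <- (scalx0 C0), norm_scal. unfold Cmod, C0; cbn.
  replace (0 * (0 * 1) + 0 * (0 * 1)) with 0 by ring. rewrite sqrt_0. ring.
Qed.

Lemma apowSr {A} {HA : banach_algebra A} (x : A) n : apow x (S n) = apow x n ** x.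
Proof.
  induction n as [|n IH]; cbn in *.
  - now rewrite mulx1, mul1x.
  - now rewrite IH at 1; rewrite mulA.
Qed.

Lemma apow_sqr {A} {HA : banach_algebra A} (x : A) k :
  apow x (2 * k) = apow (x ** x) k.
Proof.
  induction k as [|k IH]; [reflexivity|].
  replace (2 * S k)%nat with (S (S (2 * k))) by lia.
  cbn [apow]. now rewrite IH, mulA.
Qed.

Lemma norm_apow {A} {HA : banach_algebra A} (x : A) n :
  norm (apow x n) <= norm (@one A) * norm x ^ n.
Proof.
  induction n as [|n IH]; cbn [apow pow]; [lra|].
  eapply Rle_trans; [apply norm_mul|].
  pose proof (norm_ge0 x). nra.
Qed.

(** * Quasinilpotence as decay faster than every geometric sequence *)

(** Quasinilpotence without roots, equivalent to [qnil] in a Banach algebra by the two conversions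
    below; bounds of this form multiply and add directly. *)
Definition geom_bounded {A : NAlg} (x : A) :=
  forall e, 0 < e -> exists K, 0 <= K /\ forall n, norm (apow x n) <= K * e ^ n.

(** The finitely many exceptional indices are absorbed into the constant, one per induction step, at
    a cost of [Rabs (u N) / e ^ N]. *)
Lemma bounded_of_eventually (u : nat -> R) e N K : 0 < e -> 0 <= K ->
  (forall n, (n >= N)%nat -> u n <= K * e ^ n) ->
  exists L, 0 <= L /\ forall n, u n <= L * e ^ n.
Proof.
  intros He. revert K. induction N as [|N IH]; intros K HK H.
  - exists K. split; [exact HK|]. intros n. apply H. lia.
  - pose proof (pow_lt e N He) as P.
    assert (Q : 0 <= Rabs (u N) / e ^ N)
      by (apply Rmult_le_pos; [apply Rabs_pos | apply Rlt_le, Rinv_0_lt_compat, P]).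
    apply (IH (K + Rabs (u N) / e ^ N)); [lra|]. intros n Hn.
    destruct (Nat.eq_dec n N) as [->|Ne].
    + replace ((K + Rabs (u N) / e ^ N) * e ^ N) with (K * e ^ N + Rabs (u N))
        by (field; lra).
      pose proof (Rle_abs (u N)). nra.
    + pose proof (pow_lt e n He). specialize (H n ltac:(lia)). nra.
Qed.

Lemma qnil_geom_bounded {A} {HA : banach_algebra A} (x : A) :
  qnil x -> geom_bounded x.
Proof.
  intros Q e He. destruct (Q e He) as [N HN].
  (* Starting at [S N] excludes [n = 0], where [/ INR n] is not a genuine inverse. *)
  apply (bounded_of_eventually _ e (S N) 1 He Rle_0_1). intros n Hn.
  rewrite Rmult_1_l.
  specialize (HN n ltac:(lia)). unfold Rdist in HN.
  rewrite Rminus_0_r in HN. apply Rabs_def2 in HN. destruct HN as [HN _].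
  unfold nroot in HN. destruct (Rle_dec _ 0) as [L|L].
  { eapply Rle_trans; [exact L|]. apply Rlt_le, pow_lt, He. }
  apply Rnot_le_lt in L.
  rewrite <- (Rpower_1 (norm (apow x n)) L).
  assert (E : 1 = / INR n * INR n) by (rewrite Rinv_l; [easy | apply not_0_INR; lia]).
  rewrite E, <- Rpower_mult, Rpower_pow by apply exp_pos.
  apply pow_incr. split; [apply Rlt_le, exp_pos | lra].
Qed.

Lemma pow2_unbounded K : exists N, forall n, (n >= N)%nat -> K <= 2 ^ n.
Proof.
  destruct (Pow_x_infinity 2 ltac:(rewrite Rabs_pos_eq; lra) K) as [N HN].
  exists N. intros n Hn. specialize (HN n Hn).
  rewrite Rabs_pos_eq in HN; [lra | apply pow_le; lra].
Qed.

Lemma geom_bounded_qnil {A} {HA : banach_algebra A} (x : A) :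
  geom_bounded x -> qnil x.
Proof.
  (* For large [n] the constant [K] is at most [2 ^ n], so [K * (e / 4) ^ n] is at most
     [(e / 2) ^ n] and the root stays strictly below [e]. *)
  intros B e He. destruct (B (e / 4) ltac:(lra)) as (K & HK & HB).
  destruct (pow2_unbounded K) as [N HN]. exists (S N). intros n Hn.
  unfold Rdist. rewrite Rminus_0_r.
  enough (E : 0 <= nroot (norm (apow x n)) n <= e / 2)
    by (rewrite Rabs_pos_eq; lra).
  unfold nroot. destruct (Rle_dec _ 0) as [L|L]; [lra|].
  apply Rnot_le_lt in L. split; [apply Rlt_le, exp_pos|].
  assert (U : norm (apow x n) <= (e / 2) ^ n).
  { eapply Rle_trans; [apply HB|].
    replace (e / 2) with (2 * (e / 4)) by field. rewrite Rpow_mult_distr.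
    apply Rmult_le_compat_r; [apply pow_le; lra | apply HN; lia]. }
  eapply Rle_trans.
  - apply Rle_Rpower_l; [|split; [exact L | exact U]].
    apply Rlt_le, Rinv_0_lt_compat, lt_0_INR. lia.
  - rewrite <- Rpower_pow, Rpower_mult, Rinv_r, Rpower_1 by
      (try apply not_0_INR; lra || lia).
    lra.
Qed.

Lemma le_geom_eq0 z K : 0 <= z -> (forall n, z <= K * (1 / 2) ^ n) -> z = 0.
Proof.
  intros Hz H. destruct (Rle_lt_or_eq_dec 0 z Hz) as [L|]; [|easy].
  (* At such an [N] the hypothesis would give [z <= z / 2]. *)
  destruct (pow2_unbounded (2 * K / z)) as [N HN].
  specialize (HN N (le_n _)). specialize (H N).
  replace ((1 / 2) ^ N) with (/ 2 ^ N) in H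
    by (unfold Rdiv; rewrite Rmult_1_l, pow_inv; easy).
  pose proof (pow_lt 2 N ltac:(lra)) as P.
  apply (Rmult_le_compat_r (2 ^ N)) in H; [|lra].
  rewrite Rmult_assoc, Rinv_l, Rmult_1_r in H by lra.
  apply (Rmult_le_compat_r z) in HN; [|lra].
  unfold Rdiv in HN. rewrite Rmult_assoc, Rinv_l, Rmult_1_r in HN by lra. nra.
Qed.

Lemma geom_bounded_prod {A} {HA : banach_algebra A} (u x z : A) :
  geom_bounded x -> exists K, forall n,
    norm (apow u n) * norm z * norm (apow x n) <= K * (1 / 2) ^ n.
Proof.
  intros B. pose proof (norm_ge0 u) as Hu. pose proof (norm_ge0 z) as Hz.
  (* This rate times [norm u] is at most [1 / 2]; the [+ 1] covers [norm u = 0]. *)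
  destruct (B (1 / (2 * (norm u + 1)))) as (K & HK & H).
  { apply Rdiv_lt_0_compat; lra. }
  exists (norm (@one A) * norm z * K). intros n.
  pose proof (norm_apow u n) as P. specialize (H n).
  set (e := 1 / (2 * (norm u + 1))) in *.
  assert (He : 0 < e) by (apply Rdiv_lt_0_compat; lra).
  assert (G : norm u ^ n * e ^ n <= (1 / 2) ^ n).
  { rewrite <- Rpow_mult_distr. apply pow_incr. split; [nra|].
    apply (Rmult_le_reg_r (2 * (norm u + 1))); [lra|].
    replace (norm u * e * (2 * (norm u + 1))) with (norm u) by (unfold e; field; lra).
    lra. }
  pose proof (norm_ge0 (@one A)). pose proof (norm_ge0 (apow u n)).
  pose proof (norm_ge0 (apow x n)).
  pose proof (pow_le _ n Hu). pose proof (pow_lt _ n He).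
  apply Rle_trans with (norm (@one A) * norm u ^ n * norm z * (K * e ^ n)).
  - apply Rmult_le_compat; nra.
  - replace (norm one * norm u ^ n * norm z * (K * e ^ n))
      with (norm (@one A) * norm z * K * (norm u ^ n * e ^ n)) by ring.
    apply Rmult_le_compat_l; [|exact G].
    apply Rmult_le_pos; [apply Rmult_le_pos|]; easy.
Qed.

(* Iterating gives [z = u^n z x^n], and [norm (x^n)] decays faster than any
   geometric sequence. *)
Lemma qnil_fixed_right {A} {HA : banach_algebra A} (u z x : A) :
  qnil x -> z = u ** z ** x -> z = zero.
Proof.
  intros Q E. apply norm_eq0.
  destruct (geom_bounded_prod u x z (qnil_geom_bounded x Q)) as [K H].
  apply (le_geom_eq0 _ K); [apply norm_ge0|]. intros n.
  eapply Rle_trans; [|apply H].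
  assert (P : z = apow u n ** z ** apow x n).
  { clear H. induction n as [|n IH]; [cbn; now rewrite mul1x, mulx1|].
    rewrite (apowSr u). cbn [apow]. rewrite !mulA, <- (mulA _ u z).
    rewrite <- (mulA _ (u ** z) x), <- E. exact IH. }
  rewrite P at 1.
  eapply Rle_trans; [apply norm_mul|].
  apply Rmult_le_compat_r; [apply norm_ge0 | apply norm_mul].
Qed.

(** Mirror image of [qnil_fixed_right]: here [z = x^n z u^n], and the norms are reordered to reuse
    [geom_bounded_prod]. *)
Lemma qnil_fixed_left {A} {HA : banach_algebra A} (x z u : A) :
  qnil x -> z = x ** z ** u -> z = zero.
Proof.
  intros Q E. apply norm_eq0.
  destruct (geom_bounded_prod u x z (qnil_geom_bounded x Q)) as [K H].
  apply (le_geom_eq0 _ K); [apply norm_ge0|]. intros n.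
  eapply Rle_trans; [|apply H].
  assert (P : z = apow x n ** z ** apow u n).
  { clear H. induction n as [|n IH]; [cbn; now rewrite mul1x, mulx1|].
    rewrite (apowSr x). cbn [apow]. rewrite !mulA, <- (mulA _ x z).
    rewrite <- (mulA _ (x ** z) u), <- E. exact IH. }
  rewrite P at 1.
  eapply Rle_trans; [apply norm_mul|].
  rewrite (Rmult_comm (norm (apow u n))), Rmult_assoc,
    (Rmult_comm (norm (apow u n))), <- Rmult_assoc, (Rmult_comm (norm z)).
  apply Rmult_le_compat_r; [apply norm_ge0 |].
  rewrite Rmult_comm, (Rmult_comm (norm z)).
  eapply Rle_trans; [apply norm_mul|]. lra.
Qed.

(** Meant for antidiagonal matrices, whose squares are diagonal. *)
Lemma qnil_of_sqr {A} {HA : banach_algebra A} (x : A) : qnil (x ** x) -> qnil x.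
Proof.
  intros Q. apply geom_bounded_qnil. intros e He.
  destruct (qnil_geom_bounded _ Q (e ^ 2) ltac:(nra)) as (K & HK & H).
  pose proof (norm_ge0 x) as Hx.
  assert (Hq : 0 <= norm x * K / e).
  { apply Rmult_le_pos; [nra | apply Rlt_le, Rinv_0_lt_compat, He]. }
  (* [K] serves the even powers; an odd power has one extra factor [x], which costs [norm x / e]. *)
  exists (K + norm x * K / e). split; [lra|]. intros n.
  destruct (Nat.Even_or_Odd n) as [[k ->]|[k ->]].
  - rewrite apow_sqr. eapply Rle_trans; [apply H|]. rewrite <- pow_mult.
    apply Rmult_le_compat_r; [apply pow_le; lra | lra].
  - replace (2 * k + 1)%nat with (S (2 * k)) by lia. cbn [apow pow].
    rewrite apow_sqr. eapply Rle_trans; [apply norm_mul|].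
    specialize (H k). rewrite <- pow_mult in H.
    pose proof (pow_le e (2 * k) ltac:(lra)) as P.
    replace ((K + norm x * K / e) * (e * e ^ (2 * k)))
      with (K * e * e ^ (2 * k) + norm x * (K * e ^ (2 * k))) by (field; lra).
    assert (0 <= K * e * e ^ (2 * k)) by (apply Rmult_le_pos; nra).
    assert (norm x * norm (apow (x ** x) k) <= norm x * (K * e ^ (2 * k)))
      by (apply Rmult_le_compat_l; assumption).
    lra.
Qed.

(** * Sums of quasinilpotents that commute up to a scalar *)

(** One factor at a time: [(p + s q) p = p (p + s lam q)]. *)
Lemma twisted_apow {A} {HA : banach_algebra A} lam (p q : A) s n :
  q ** p = scal lam (p ** q) ->
  apow (p |+| scal s q) n ** p = p ** apow (p |+| scal (Cmul s lam) q) n.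
Proof.
  intros E. induction n as [|n IH]; [cbn; now rewrite mul1x, mulx1|].
  cbn [apow]. rewrite <- mulA, IH, !mulA. f_equal.
  rewrite mulDl, mulDr. f_equal.
  now rewrite <- scal_mull, E, scalM, scal_mulr, scal_mulr.
Qed.

(* Moving a factor [p] to the left through [(p + s q)^n] only multiplies [s] by
   [lam]; as [|lam| <= 1], the bound below, uniform in [|s| <= 1], is inductive. *)
Lemma twisted_bound {A} {HA : banach_algebra A} lam (p q : A) e Kp Kq :
  q ** p = scal lam (p ** q) -> Cmod lam <= 1 ->
  (forall n, norm (apow p n) <= Kp * e ^ n) ->
  (forall n, norm (apow q n) <= Kq * e ^ n) ->
  forall n s i j, Cmod s <= 1 ->
    norm (apow p i ** apow (p |+| scal s q) n ** apow q j)
    <= Kp * Kq * 2 ^ n * e ^ (i + n + j).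
Proof.
  intros E L Hp Hq n. induction n as [|n IH]; intros s i j Hs.
  - cbn [apow]. rewrite mulx1. eapply Rle_trans; [apply norm_mul|].
    apply Rle_trans with (Kp * e ^ i * (Kq * e ^ j)).
    + apply Rmult_le_compat; auto using norm_ge0.
    + right. rewrite Nat.add_0_r, pow_add. cbn. ring.
  (* The last factor is split: its [p] joins [apow p i], its [q] joins [apow q j]. The two summands
     account for one factor 2. *)
  - rewrite apowSr, mulDr, (twisted_apow _ _ _ _ _ E).
    replace (apow p i ** (p ** apow (p |+| scal (Cmul s lam) q) n |+|
       apow (p |+| scal s q) n ** scal s q) ** apow q j)
      with (apow p (S i) ** apow (p |+| scal (Cmul s lam) q) n ** apow q j |+|
         scal s (apow p i ** apow (p |+| scal s q) n ** apow q (S j))).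
    2:{ rewrite mulDr, mulDl. f_equal.
        - now rewrite apowSr, !mulA.
        - cbn [apow].
          now rewrite <- scal_mulr, <- scal_mulr, <- scal_mull, !mulA. }
    eapply Rle_trans; [apply norm_add|]. rewrite norm_scal.
    assert (Hl : Cmod (Cmul s lam) <= 1).
    { rewrite Cmod_mul. pose proof (Cmod_ge0 s). pose proof (Cmod_ge0 lam). nra. }
    pose proof (IH (Cmul s lam) (S i) j Hl) as B1.
    pose proof (IH s i (S j) Hs) as B2.
    replace (S i + n + j)%nat with (i + S n + j)%nat in B1 by lia.
    replace (i + n + S j)%nat with (i + S n + j)%nat in B2 by lia.
    cbn [pow].
    pose proof (norm_ge0 (apow p i ** apow (p |+| scal s q) n ** apow q (S j))).
    pose proof (Cmod_ge0 s). nra.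
Qed.

Lemma qnil_add_small {A} {HA : banach_algebra A} lam (p q : A) :
  qnil p -> qnil q -> q ** p = scal lam (p ** q) -> Cmod lam <= 1 ->
  qnil (p |+| q).
Proof.
  intros Hp Hq E L. apply geom_bounded_qnil. intros e He.
  (* Halving the rate compensates the [2 ^ n] of [twisted_bound], used with [s = 1] and
     [i = j = 0]. *)
  destruct (qnil_geom_bounded p Hp (e / 2) ltac:(lra)) as (Kp & P0 & BP).
  destruct (qnil_geom_bounded q Hq (e / 2) ltac:(lra)) as (Kq & Q0 & BQ).
  exists (Kp * Kq). split; [nra|]. intros n.
  pose proof (twisted_bound lam p q (e / 2) Kp Kq E L BP BQ n Defs.C1 0 0) as B.
  cbn [apow Nat.add] in B. rewrite scal1, mul1x, mulx1, Nat.add_0_r in B.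
  specialize (B ltac:(rewrite Cmod_C1; lra)).
  eapply Rle_trans; [exact B|]. right.
  rewrite Rmult_assoc, <- Rpow_mult_distr. do 2 f_equal. field.
Qed.

Lemma scal_swap {A} {HA : banach_algebra A} lam mu (x y : A) :
  Cmul mu lam = Defs.C1 -> x = scal lam y -> y = scal mu x.
Proof. intros E ->. now rewrite <- scalM, E, scal1. Qed.

(** Either [lam] or its inverse has modulus at most 1, and exchanging [p] and [q] replaces one by
    the other. *)
Lemma qnil_add {A} {HA : banach_algebra A} lam (p q : A) :
  lam <> C0 -> qnil p -> qnil q -> q ** p = scal lam (p ** q) -> qnil (p |+| q).
Proof.
  intros N Hp Hq E. destruct (Cinv_exists lam N) as [mu Hmu].
  destruct (Rle_lt_dec (Cmod lam) 1) as [L|L].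
  - now apply (qnil_add_small lam).
  - rewrite addC. apply (qnil_add_small mu); auto.
    + now apply (scal_swap lam).
    + pose proof (f_equal Cmod Hmu) as M. rewrite Cmod_mul, Cmod_C1 in M.
      pose proof (Cmod_ge0 mu). nra.
Qed.

(** * Additive perturbation of g-Drazin inverses *)

Lemma mul2_eq {A} {HA : banach_algebra A} (x y w : A) :
  x ** y = w -> forall t, t ** x ** y = t ** w.
Proof. intros E t. now rewrite <- mulA, E. Qed.

Lemma mul3_eq {A} {HA : banach_algebra A} (x y z w : A) :
  x ** y ** z = w -> forall t, t ** x ** y ** z = t ** w.
Proof. intros E t. now rewrite <- E, !mulA. Qed.

Lemma mul4_eq {A} {HA : banach_algebra A} (x y z v w : A) :
  x ** y ** z ** v = w -> forall t, t ** x ** y ** z ** v = t ** w.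
Proof. intros E t. now rewrite <- E, !mulA. Qed.

(* Rewrites with [E : w' = w], where [w'] has two to four letters, anywhere inside a
   left-associated word. *)
Ltac word E :=
  first [rewrite (mul4_eq _ _ _ _ _ E) | rewrite (mul3_eq _ _ _ _ E) | rewrite (mul2_eq _ _ _ E) | rewrite E];
  rewrite ?mulA, ?mulx0, ?mul0x.

Ltac expand := unfold spi;
  rewrite ?mulBr, ?mulBl, ?mulDr, ?mulDl, ?mulBr, ?mulBl, ?mul1x, ?mulx1, ?mulA.

Lemma gdrazin_words {A} {HA : banach_algebra A} (x y : A) :
  gdrazin_inv x y -> y ** x = x ** y /\ x ** y ** y = y.
Proof. intros (E1 & E2 & _). split; [easy|]. now rewrite <- E1. Qed.

(* Both halves come from a fixed point [z = u z w] with one factor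
   quasinilpotent. *)
Lemma gdrazin_intertwine {A} {HA : banach_algebra A} (x xd y yd b : A) :
  gdrazin_inv x xd -> gdrazin_inv y yd -> x ** b = b ** y ->
  xd ** b = b ** yd.
Proof.
  intros X Y E. destruct (gdrazin_words _ _ X) as [X1 X2].
  destruct (gdrazin_words _ _ Y) as [Y1 Y2].
  destruct X as (_ & _ & X3), Y as (_ & _ & Y3).
  (* The difference [z] of the two sides satisfies [z = (x - x x xd) z yd], because
     [x b yd yd = b y yd yd = b yd]. *)
  assert (E1 : b ** yd = x ** xd ** b ** yd).
  { apply sub_eq0. refine (qnil_fixed_left _ _ yd X3 _). expand.
    word E. word Y2.
    repeat word X1. repeat word X2.
    assert (G : x ** x ** xd ** b ** yd ** yd = x ** xd ** b ** yd)
      by (rewrite <- (mulA x x xd); rewrite <- X1 at 1; rewrite mulA;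
          word E; word Y2; reflexivity).
    rewrite G.
    rewrite subxx, subx0. reflexivity. }
  (* Dually [z = xd z (y - y y yd)], because [xd xd b y = xd xd x b = xd b]. *)
  assert (E2 : xd ** b = xd ** b ** y ** yd).
  { apply sub_eq0. refine (qnil_fixed_right xd _ _ Y3 _). expand.
    repeat word Y1. repeat word Y2.
    assert (G : xd ** xd ** b ** y = xd ** b)
      by (word (eq_sym E); word X1; word X1; word X2; reflexivity).
    rewrite G, !subxx, !subx0. reflexivity. }
  rewrite E2. rewrite <- (mulA xd b y), <- E, mulA, X1. now symmetry.
Qed.

Lemma gdrazin_annihilate {A} {HA : banach_algebra A} lam (p q pd qd : A) :
  lam <> C0 -> gdrazin_inv p pd -> gdrazin_inv q qd ->
  q ** p = scal lam (spi q qd ** p ** q ** spi p pd) ->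
  q ** p = scal lam (p ** q) /\ qd ** p = zero /\ q ** pd = zero /\
  pd ** q = zero /\ p ** qd = zero.
Proof.
  intros N P Q E. destruct (gdrazin_words _ _ P) as [P1 P2].
  destruct (gdrazin_words _ _ Q) as [Q1 Q2].
  destruct P as (_ & _ & P3), Q as (_ & _ & Q3).
  destruct (Cinv_exists lam N) as [mu Hmu].
  assert (A1 : qd ** p = zero).
  { assert (W : qd ** qd ** q = qd) by (word Q1; word Q1; word Q2; reflexivity).
    rewrite <- W, <- mulA, E, <- scal_mulr, !mulA.
    replace (qd ** qd ** spi q qd) with (@zero A)
      by (expand; rewrite W, subxx; reflexivity).
    now rewrite !mul0x, scalx0. }
  assert (A2 : q ** pd = zero).
  { assert (W : spi p pd ** pd ** pd = zero)
      by (expand; rewrite P2, subxx; reflexivity).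
    rewrite <- P2, !mulA, E, <- !scal_mull, <- !mulA, (mulA (spi p pd)), W.
    now rewrite !mulx0, scalx0. }
  assert (A2' : q ** p ** pd = zero) by (word (eq_sym P1); word A2; reflexivity).
  (* Since [qd p = 0] and [q p pd = 0], both spectral idempotents drop out. *)
  assert (A3 : q ** p = scal lam (p ** q)).
  { rewrite E. f_equal. expand. word A2'. word A1.
    rewrite ?mul0x, ?mulx0, !subx0. reflexivity. }
  pose proof (scal_swap _ _ _ _ Hmu A3) as A4.
  (* [pd q = pd pd p q = mu pd pd q p], and [q p = q (p - p p pd)]: a fixed point with a
     quasinilpotent factor on the right. *)
  assert (A5 : pd ** q = zero).
  { refine (qnil_fixed_right (scal mu pd) _ _ P3 _).
    assert (W : q ** (p |-| p ** p ** pd) = q ** p).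
    { expand. word (eq_sym P1). word A2'. now rewrite ?mul0x, subx0. }
    rewrite <- mulA, <- (mulA pd q), W, <- scal_mull, 2!(scal_mulr mu pd), <- A4, !mulA.
    word P1. word P1. word P2. reflexivity. }
  (* Symmetrically, [p qd = p q qd qd = mu q p qd qd], and [q p = (q - q q qd) p]. *)
  assert (A6 : p ** qd = zero).
  { refine (qnil_fixed_left _ _ (scal mu qd) Q3 _).
    assert (W : (q |-| q ** q ** qd) ** p = q ** p).
    { expand. word A1. now rewrite subx0. }
    rewrite mulA, W, <- scal_mulr, 2!(scal_mull mu _ qd), <- A4.
    word Q2. reflexivity. }
  auto.
Qed.

(** With the mixed products zero, [p + q] and [pd + qd] multiply to [p pd + q qd] in either
    order. *)
Lemma gdrazin_add {A} {HA : banach_algebra A} lam (p q pd qd : A) :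
  lam <> C0 -> gdrazin_inv p pd -> gdrazin_inv q qd ->
  q ** p = scal lam (p ** q) -> qd ** p = zero -> q ** pd = zero ->
  pd ** q = zero -> p ** qd = zero ->
  gdrazin_inv (p |+| q) (pd |+| qd).
Proof.
  intros N P Q E A1 A2 A3 A4. destruct (gdrazin_words _ _ P) as [P1 P2].
  destruct (gdrazin_words _ _ Q) as [Q1 Q2].
  destruct P as (_ & _ & P3), Q as (_ & _ & Q3).
  assert (F : (p |+| q) ** (pd |+| qd) = p ** pd |+| q ** qd)
    by now rewrite mulDl, !mulDr, A2, A4, addx0, add0x.
  assert (F' : (pd |+| qd) ** (p |+| q) = p ** pd |+| q ** qd)
    by now rewrite mulDl, !mulDr, A1, A3, addx0, add0x, P1, Q1.
  split; [|split].
  - now rewrite F, F'.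
  - assert (W1 : qd ** pd = zero)
      by (rewrite <- P2, !mulA, A1, !mul0x; reflexivity).
    assert (W2 : pd ** qd = zero)
      by (rewrite <- Q2, !mulA, A3, !mul0x; reflexivity).
    rewrite F'. expand. word W1. word W2. now rewrite P2, Q2, addx0, add0x.
  - rewrite <- mulA, F. expand.
    assert (W1 : q ** p ** pd = zero) by (word (eq_sym P1); word A2; reflexivity).
    assert (W2 : p ** q ** qd = zero) by (word (eq_sym Q1); word A4; reflexivity).
    (* The quasinilpotent parts of [p] and [q] add up. Their products in the two orders reduce to
       [q p] and [p q], so they too commute up to [lam]. *)
    rewrite W1, W2, addx0, add0x, addBB. apply (qnil_add lam); auto.
    expand.
    assert (W3 : q ** q ** qd ** p = zero) by (word A1; reflexivity).
    assert (W4 : p ** q ** q ** qd = zero)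
      by (rewrite <- (mulA _ q qd), <- Q1, !mulA; word (eq_sym Q1); word A4;
          now rewrite ?mul0x).
    assert (W5 : q ** p ** p ** pd = zero) by (word (eq_sym P1); word W1; now rewrite ?mul0x).
    now rewrite W3, W4, W5, E, <- (mulA (p ** p) pd q), A3, !mulx0, !mul0x, !subx0.
Qed.

(** * The algebra of 2 x 2 matrices *)

Lemma addACA {A} {HA : banach_algebra A} (x y z t : A) :
  x |+| y |+| (z |+| t) = x |+| z |+| (y |+| t).
Proof. now rewrite <- !addA, (addA y), (addC y z), <- addA. Qed.

Lemma norm_mul_add_le {A} {HA : banach_algebra A} (x y z t : A) :
  norm (x ** y |+| z ** t) <= norm x * norm y + norm z * norm t.
Proof.
  eapply Rle_trans; [apply norm_add|].
  apply Rplus_le_compat; apply norm_mul.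
Qed.

Lemma M2_complete {A} {HA : banach_algebra A} (u : nat -> M2 A) :
  cauchy u -> exists l, converges_to u l.
Proof.
  intros C.
  (* A map that does not increase distances sends the Cauchy sequence to a convergent one; the four
     entry maps are of this kind. *)
  assert (G : forall f : M2 A -> A,
    (forall X Y : M2 A, norm (f X |-| f Y) <= norm (X |-| Y)) ->
    exists l, converges_to (fun n => f (u n)) l).
  { intros f Hf. apply banach_complete. intros e He.
    destruct (C e He) as [N HN]. exists N. intros m n Hm Hn.
    eapply Rle_lt_trans; [apply Hf | auto]. }
  assert (N0 : forall (X Y : M2 A),
    norm (m11 X |-| m11 Y) <= norm (X |-| Y) /\ norm (m12 X |-| m12 Y) <= norm (X |-| Y) /\
    norm (m21 X |-| m21 Y) <= norm (X |-| Y) /\ norm (m22 X |-| m22 Y) <= norm (X |-| Y)).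
  { intros X Y. cbn.
    pose proof (norm_ge0 (m11 X |-| m11 Y)). pose proof (norm_ge0 (m12 X |-| m12 Y)).
    pose proof (norm_ge0 (m21 X |-| m21 Y)). pose proof (norm_ge0 (m22 X |-| m22 Y)).
    unfold sub in *. repeat split; lra. }
  destruct (G m11) as [l1 L1]; [apply N0|]. destruct (G m12) as [l2 L2]; [apply N0|].
  destruct (G m21) as [l3 L3]; [apply N0|]. destruct (G m22) as [l4 L4]; [apply N0|].
  exists (mk2 l1 l2 l3 l4 : M2 A). intros e He.
  destruct (L1 (e / 4) ltac:(lra)) as [N1 H1]. destruct (L2 (e / 4) ltac:(lra)) as [N2 H2].
  destruct (L3 (e / 4) ltac:(lra)) as [N3 H3]. destruct (L4 (e / 4) ltac:(lra)) as [N4 H4].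
  exists (N1 + N2 + N3 + N4)%nat. intros n Hn.
  specialize (H1 n ltac:(lia)). specialize (H2 n ltac:(lia)).
  specialize (H3 n ltac:(lia)). specialize (H4 n ltac:(lia)).
  unfold sub in *. cbn. lra.
Qed.

Lemma M2_norm_add {A} {HA : banach_algebra A} (X Y : M2 A) :
  norm (X |+| Y) <= norm X + norm Y.
Proof.
  cbn. pose proof (norm_add (m11 X) (m11 Y)). pose proof (norm_add (m12 X) (m12 Y)).
  pose proof (norm_add (m21 X) (m21 Y)). pose proof (norm_add (m22 X) (m22 Y)). lra.
Qed.

Lemma M2_norm_mul {A} {HA : banach_algebra A} (X Y : M2 A) :
  norm (X ** Y) <= norm X * norm Y.
Proof.
  destruct X as [x y z t], Y as [x' y' z' t']. cbn.
  pose proof (norm_mul_add_le x x' y z'). pose proof (norm_mul_add_le x y' y t').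
  pose proof (norm_mul_add_le z x' t z'). pose proof (norm_mul_add_le z y' t t').
  pose proof (norm_ge0 x). pose proof (norm_ge0 y).
  pose proof (norm_ge0 z). pose proof (norm_ge0 t).
  pose proof (norm_ge0 x'). pose proof (norm_ge0 y').
  pose proof (norm_ge0 z'). pose proof (norm_ge0 t'). nra.
Qed.

#[local] Instance M2_banach {A} {HA : banach_algebra A} : banach_algebra (M2 A).
Proof.
  unfold banach_algebra. repeat apply conj; cbn; intros;
    repeat match goal with X : Mat2 _ |- _ => destruct X end; cbn in *;
    rewrite ?mulDl, ?mulDr, ?mulx0, ?mul0x, ?mulx1, ?mul1x, ?addx0, ?add0x.
  all: try (f_equal; now rewrite ?mulDl, ?mulDr, ?mulA, ?addA, ?addx0, ?addxN, ?scalM,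
       ?scal1, ?scalDl, ?scalDr, ?scal_mull).
  all: try (f_equal; apply addC).
  all: try (f_equal; rewrite ?mulDl, ?mulDr, ?mulA; apply addACA).
  all: try (f_equal; now rewrite scalDr, !scal_mulr).
  - repeat apply Rplus_le_le_0_compat; apply norm_ge0.
  - match goal with E : norm ?x + norm ?y + norm ?z + norm ?t = 0 |- _ =>
      pose proof (norm_ge0 x); pose proof (norm_ge0 y);
      pose proof (norm_ge0 z); pose proof (norm_ge0 t) end.
    f_equal; apply norm_eq0; lra.
  - apply (M2_norm_add (mk2 _ _ _ _) (mk2 _ _ _ _)).
  - rewrite !norm_scal. ring.
  - apply (M2_norm_mul (mk2 _ _ _ _) (mk2 _ _ _ _)).
  - now apply M2_complete.
Qed.

(** * g-Drazin inverses of diagonal and antidiagonal matrices *)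

Lemma qnil_diag {A} {HA : banach_algebra A} (x y : A) :
  qnil x -> qnil y -> qnil (mk2 x zero zero y : M2 A).
Proof.
  intros X Y. apply geom_bounded_qnil. intros e He.
  destruct (qnil_geom_bounded x X e He) as (K & HK & BK).
  destruct (qnil_geom_bounded y Y e He) as (L & HL & BL).
  exists (K + L). split; [lra|]. intros n.
  assert (P : apow (mk2 x zero zero y : M2 A) n = mk2 (apow x n) zero zero (apow y n)).
  { induction n as [|n IH]; [reflexivity|].
    cbn [apow]. rewrite IH. cbn. now rewrite !mulx0, !mul0x, !addx0, !add0x. }
  rewrite P. cbn. rewrite norm_zero. specialize (BK n). specialize (BL n). lra.
Qed.

Ltac mat := cbn; repeat progress rewrite ?mulx0, ?mul0x, ?addx0, ?add0x, ?subx0, ?mulA.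

Lemma gdrazin_diag {A} {HA : banach_algebra A} (a d ad dd : A) :
  gdrazin_inv a ad -> gdrazin_inv d dd ->
  gdrazin_inv (mk2 a zero zero d : M2 A) (mk2 ad zero zero dd).
Proof.
  intros (A1 & A2 & A3) (D1 & D2 & D3). split; [|split].
  - mat. now rewrite A1, D1.
  - mat. now rewrite <- A2, <- D2.
  - unfold sub. mat. rewrite opp0. exact (qnil_diag _ _ A3 D3).
Qed.

(** The two factors are the off-diagonal entries of [Q - Q Q Qd] for the antidiagonal [Q]; their
    product, a diagonal entry of its square, is the quasinilpotent part of [b c]. *)
Lemma antidiag_corner {A} {HA : banach_algebra A} (b c bcd cbd : A) :
  gdrazin_inv (b ** c) bcd -> gdrazin_inv (c ** b) cbd ->
  (b |-| b ** c ** b ** cbd) ** (c |-| c ** b ** c ** bcd) =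
  b ** c |-| b ** c ** b ** c ** bcd.
Proof.
  intros X Y.
  assert (E2 : cbd ** c = c ** bcd)
    by (apply (gdrazin_intertwine _ _ _ _ _ Y X); now rewrite mulA).
  destruct (gdrazin_words _ _ X) as [X1 X2]. rewrite !mulA in X1.
  expand. repeat word E2. word X1. word X2. now rewrite subxx, subx0.
Qed.

Lemma gdrazin_antidiag {A} {HA : banach_algebra A} (b c bcd cbd : A) :
  gdrazin_inv (b ** c) bcd -> gdrazin_inv (c ** b) cbd ->
  gdrazin_inv (mk2 zero b c zero : M2 A) (mk2 zero (b ** cbd) (c ** bcd) zero).
Proof.
  intros X Y.
  assert (E1 : bcd ** b = b ** cbd)
    by (apply (gdrazin_intertwine _ _ _ _ _ X Y); now rewrite mulA).
  assert (E2 : cbd ** c = c ** bcd)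
    by (apply (gdrazin_intertwine _ _ _ _ _ Y X); now rewrite mulA).
  destruct (gdrazin_words _ _ X) as [X1 X2]. destruct (gdrazin_words _ _ Y) as [Y1 Y2].
  pose proof (antidiag_corner b c bcd cbd X Y) as C1.
  pose proof (antidiag_corner c b cbd bcd Y X) as C2.
  rewrite !mulA in *. split; [|split].
  - mat. f_equal.
    + word E2. reflexivity.
    + word E1. reflexivity.
  - mat. f_equal.
    + word E2. word (eq_sym E1). rewrite X2. now symmetry.
    + word E1. word (eq_sym E2). rewrite Y2. now symmetry.
  (* The square is diagonal, with the quasinilpotent parts of [b c] and [c b] as entries. *)
  - destruct X as (_ & _ & X3), Y as (_ & _ & Y3). apply qnil_of_sqr.
    rewrite !mulA in *.
    pose proof (qnil_diag _ _ X3 Y3) as D. rewrite <- C1, <- C2 in D.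
    unfold sub in *. mat. rewrite !opp0. mat. exact D.
Qed.

(** * Vanishing of the series and the formula for the inverse *)

Lemma has_sum_zero {A} {HA : banach_algebra A} (f : nat -> A) :
  (forall n, f n = zero) -> has_sum f zero.
Proof.
  intros F e He. exists 0%nat. intros n _.
  assert (P : psum f n = zero).
  { induction n as [|n IH]; cbn; [apply F|]. now rewrite IH, F, addx0. }
  now rewrite P, subxx, norm_zero.
Qed.

Theorem theorem3p1 (A : NAlg) (HA : banach_algebra A) (lam : Cplx) (Hlam : lam <> C0)
  (a b c d ad dd bcd cbd : A)
  (Had : gdrazin_inv a ad) (Hdd : gdrazin_inv d dd)
  (Hbc : gdrazin_inv (b ** c) bcd) (Hcb : gdrazin_inv (c ** b) cbd)
  (H1 : b ** d = scal lam (spi (b ** c) bcd ** a ** b ** spi d dd))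
  (H2 : c ** a = scal lam (spi (c ** b) cbd ** d ** c ** spi a ad)) :
  let M : M2 A := mk2 a b c d in
  let P : M2 A := mk2 a zero zero d in
  let Q : M2 A := mk2 zero b c zero in
  let Pd : M2 A := mk2 ad zero zero dd in
  let Qd : M2 A := mk2 zero (b ** cbd) (c ** bcd) zero in
  let E0 : M2 A := mk2 (ad ** spi (b ** c) bcd) (spi a ad ** b ** cbd)
                       (spi d dd ** c ** bcd) (dd ** spi (c ** b) cbd) in
  exists (S1 S2 S3 S4 : M2 A) (T : nat -> M2 A),
    has_sum (fun n => apow Pd (n + 2) ** Q ** apow M n ** spi Q Qd) S1 /\
    has_sum (fun n => apow M n ** P ** apow Qd (n + 2)) S2 /\
    (forall n, has_sum (fun k => apow Pd (k + 1) ** Q ** apow M (n + k) ** P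
                                  ** apow Qd (n + 2)) (T n)) /\
    has_sum T S3 /\
    has_sum (fun n => apow Pd (n + 2) ** Q ** apow M n ** P ** Qd) S4 /\
    gdrazin_inv M (E0 |+| S1 |+| spi P Pd ** S2 |-| S3 |-| S4).
Proof.
  intros M P Q Pd Qd E0.
  pose proof (gdrazin_diag a d ad dd Had Hdd : gdrazin_inv P Pd) as GP.
  pose proof (gdrazin_antidiag b c bcd cbd Hbc Hcb : gdrazin_inv Q Qd) as GQ.
  assert (EM : M = P |+| Q) by (unfold M, P, Q; mat; reflexivity).
  (* [spi Q Qd] is diagonal with entries [spi (b ** c) bcd] and [spi (c ** b) cbd], so [H1] and [H2]
     are the two off-diagonal entries of this equation. *)
  assert (E : Q ** P = scal lam (spi Q Qd ** P ** Q ** spi P Pd)).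
  { unfold P, Q, Pd, Qd. unfold spi, sub in *. mat. repeat progress (rewrite ?opp0; mat).
    rewrite H1, H2, ?scalx0, ?mulA. reflexivity. }
  destruct (gdrazin_annihilate lam P Q Pd Qd Hlam GP GQ E) as (E1 & E2 & E3 & E4 & E5).
  assert (F0 : E0 = Pd ** spi Q Qd |+| spi P Pd ** Qd).
  { unfold E0, P, Q, Pd, Qd, spi, sub. mat. repeat progress (rewrite ?opp0; mat).
    reflexivity. }
  (* [Pd Q = 0] removes both corrections, the second through [P Pd Qd = P Pd Q Qd Qd]. *)
  assert (F1 : E0 = Pd |+| Qd).
  { rewrite F0. expand. rewrite E4.
    rewrite <- (mulA P Pd), <- (proj2 (gdrazin_words _ _ GQ)), !mulA,
      <- (mulA P Pd Q), E4. now rewrite !mulx0, !mul0x, !subx0. }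
  (* Every term of the first and last series contains [Pd Q]; every term of the second and of the
     double series contains [P Qd]. *)
  assert (L : forall n X, apow Pd (n + 1) ** Q ** X = zero).
  { intros n X. replace (n + 1)%nat with (S n) by lia.
    now rewrite apowSr, <- (mulA _ Pd Q), E4, mulx0, mul0x. }
  assert (L2 : forall n X, apow Pd (n + 2) ** Q ** X = zero)
    by (intros n X; replace (n + 2)%nat with (S n + 1)%nat by lia; apply L).
  assert (R : forall n X, X ** P ** apow Qd (n + 2) = zero).
  { intros n X. replace (n + 2)%nat with (S (S n)) by lia. cbn [apow].
    now rewrite !mulA, <- (mulA X P Qd), E5, mulx0, !mul0x. }
  exists zero, zero, zero, zero, (fun _ => zero).
  split; [|split; [|split; [|split; [|split]]]].
  - apply has_sum_zero. intros n. now rewrite L2, mul0x.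
  - apply has_sum_zero. intros n. apply R.
  - intros n. apply has_sum_zero. intros k. apply R.
  - now apply has_sum_zero.
  - apply has_sum_zero. intros n. now rewrite L2, !mul0x.
  - rewrite mulx0, !addx0, !subx0, F1, EM. now apply (gdrazin_add lam).
Qed.
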